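(* Let $X$ be a finite subset of a torsion-free abelian group, let $2\le a<3$, and let $K\ge1$. Suppose that for every $\eta>0$ there is $C_\eta$ such that $$E(A)\le C_\eta K^{3-a}|A|^{a+\eta}\qquad(A\subset X).$$ Then, for every $\varepsilon>0$, there is $\eta=\eta(a,\varepsilon)>0$ such that every complex-valued $f$ supported on $X$ satisfies $$\|\widehat f\|_{L^4}\ll_{a,\varepsilon}C_\eta^{1/4}K^{(3-a)/4}|X|^{\varepsilon}\|f\|_{\ell^{4/a}},$$ where the implied constant depends only on $a$ and $\varepsilon$.
   Context: $E(A)=\sum_t r_{A-A}(t)^2$ with $r_{A-A}(t)=\#\{(x,y)\in A^2:x-y=t\}$. The subgroup generated by the finite set $X$ is isomorphic to some $\mathbb Z^r$; fixing such an identification, $\widehat f$ is the Fourier series of $f$ on $\mathbb T^r$, $\widehat f(\xi)=\sum_x f(x)e^{-2\pi i x\cdot\xi}$, and $\|\cdot\|_{L^4}$ is the norm of $L^4(\mathbb T^r)$ with normalized Haar measure. The $\ell^p$ norms are with respect to counting measure. *)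

(* Defs.v *)
From HB Require Import structures.
From mathcomp Require Import all_boot all_order all_algebra finmap.
From mathcomp Require Import complex.
From mathcomp Require Import all_classical all_reals all_analysis.

Set Implicit Arguments.
Unset Strict Implicit.
Unset Printing Implicit Defensive.

Import Order.TTheory GRing.Theory Num.Theory.
Import numFieldNormedType.Exports.

Local Open Scope classical_set_scope.
Local Open Scope ring_scope.

Definition torsion_free (G : zmodType) : Prop :=
  forall (x : G) (n : nat), (0 < n)%N -> x *+ n = 0 -> x = 0.

Definition is_subgroup (G : zmodType) (H : set G) : Prop :=
  H 0 /\ forall x y, H x -> H y -> H (x - y).

Definition gen_subgroup (G : zmodType) (X : {fset G}) : set G :=
  smallest (@is_subgroup G) [set` X].

(* [psi] is a group isomorphism from the subgroup generated by [X] onto Z^r;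
   its values outside this subgroup are irrelevant. *)
Definition is_identification (G : zmodType) (X : {fset G}) (r : nat)
    (psi : G -> 'rV[int]_r) : Prop :=
  (forall x y, gen_subgroup X x -> gen_subgroup X y ->
     psi (x + y) = psi x + psi y) /\
  set_bij (gen_subgroup X) [set: 'rV[int]_r] psi.

Definition diff_rep (G : zmodType) (A : {fset G}) (t : G) : nat :=
  #|` [fset z in (A `*` A)%fset | z.1 - z.2 == t]%fset |.

(* Only finitely many terms of the sum are nonzero. *)
Definition energy (G : zmodType) (A : {fset G}) : nat :=
  (\sum_(t \in [set: G]) diff_rep A t ^ 2)%N.

Section FourierSeries.
Context {R : realType}.

Definition expi (t : R) : R[i] := Complex (cos t) (sin t).

Definition supported_on (G : zmodType) (X : {fset G}) (f : G -> R[i]) : Prop :=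
  forall x, x \notin X -> f x = 0.

Definition dot (r : nat) (m : 'rV[int]_r) (xi : r.-tuple R) : R :=
  \sum_(i < r) (m ord0 i)%:~R * tnth xi i.

(* [\sum_(x \in [set: G])] is the sum of the nonzero terms when there are
   finitely many of them, which is the case for finitely supported [f]. *)
Definition fourier (G : zmodType) (r : nat) (psi : G -> 'rV[int]_r)
    (f : G -> R[i]) (xi : r.-tuple R) : R[i] :=
  \sum_(x \in [set: G]) f x * expi (- (2 * pi * dot (psi x) xi)).

Definition lp_norm (G : zmodType) (p : R) (f : G -> R[i]) : R :=
  (\sum_(x \in [set: G]) Normc.normc (f x) `^ p) `^ p^-1.

Definition tcons (n : nat) (z : measurableTypeR R * n.-tuple (measurableTypeR R)) :
  n.+1.-tuple (measurableTypeR R) := [tuple of z.1 :: z.2].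

Lemma measurable_tcons (n : nat) : measurable_fun setT (@tcons n).
Proof. exact: measurable_cons. Qed.

HB.instance Definition _ (n : nat) :=
  isMeasurableFun.Build _ _ _ _ (@tcons n) (@measurable_tcons n).

(* Normalized Haar measure on T^r = (R/Z)^r, carried by the fundamental domain
   [0, 1]^r: the r-fold product of the uniform probability on [0, 1].  Functions
   on T^r are identified with Z^r-periodic functions on R^r. *)
Fixpoint haar (r : nat) : probability (r.-tuple (measurableTypeR R)) R :=
  if r is n.+1 then
    distribution (uniform_prob (@ltr01 R) \x haar n)%E (@tcons n)
  else \d_[tuple].

Definition L4_norm (r : nat) (F : r.-tuple R -> R[i]) : \bar R :=
  'N[haar r]_4%:E[(fun xi => (Normc.normc (F xi))%:E)].

End FourierSeries.

(* Main.v *)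
Require Import Defs.
From mathcomp Require Import all_boot all_order all_algebra finmap.
From mathcomp Require Import complex.
From mathcomp Require Import all_classical all_reals all_analysis.
From mathcomp Require Import measurable_realfun ring lra.
Set Implicit Arguments.
Unset Strict Implicit.
Unset Printing Implicit Defensive.
Import Order.TTheory GRing.Theory Num.Theory.
Import numFieldNormedType.Exports.
Local Open Scope ring_scope.

(** Expanding the fourth power of the modulus and integrating term by term
gives the fourth power of the L^4 norm of the Fourier series of f as the sum of
  f(x) conj(f(y)) conj(f(x')) f(y')
over the quadruples with psi x - psi y = psi x' - psi y', and because psi is an
injective homomorphism on the group generated by X these are the quadruples
with x - y = x' - y'.  By the triangle inequality the sum is at most
self_energy |f|, the additive energy with weights |f|; on the indicator of a
set A the self energy is E(A) (energy_imfset).  The problem is thereby reduced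
to an inequality for nonnegative weights (L4_norm_trig_sum_le).

The fourth root of the self energy is subadditive on nonnegative weights
(self_energy_subadditive), which follows from two applications of
Cauchy-Schwarz.  Enumerate X so that the values w_0 >= w_1 >= ... of |f|
decrease, put w_n = 0 for n = |X|, and write |f| as the sum of
(w_k - w_(k+1)) 1_(A_k), where A_k consists of the first k+1 points.  With
D = C_eta K^(3-a) and b = (a + eta) / 4, the hypothesis on E(A_k) gives
  (self_energy |f|)^(1/4) <= D^(1/4) sum_k (w_k - w_(k+1)) (k+1)^b.
Summation by parts turns the last sum into sum_k w_k ((k+1)^b - k^b).  Here
w_k <= ||f|| (k+1)^(-a/4) in terms of the l^(4/a) norm, and if b <= 1 then
(k+1)^b - k^b <= (k+1)^(b-1); so the sum is at most
  ||f|| sum_k (k+1)^(eta/4 - 1) <= (4 / eta) n^(eta/4) ||f||.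
The choice eta = min(4 eps, 1) ensures both eta/4 <= eps and, as a < 3,
b <= 1; the constant is then 4 / eta. *)

(** * The quadrilinear energy form *)

Lemma cauchy_schwarz_seq (R : realFieldType) (J : Type) (s : seq J) (a b : J -> R) :
  (\sum_(t <- s) a t * b t) ^+ 2
  <= (\sum_(t <- s) a t * a t) * (\sum_(t <- s) b t * b t).
Proof.
have : 0 <= \sum_(t <- s) \sum_(t' <- s) (a t * b t' - a t' * b t) ^+ 2.
  by apply: sumr_ge0 => t _; apply: sumr_ge0 => t' _; exact: sqr_ge0.
have dsum (f g : J -> R) : \sum_(t <- s) \sum_(t' <- s) f t * g t' =
    (\sum_(t <- s) f t) * (\sum_(t <- s) g t).
  by rewrite mulr_suml; apply: eq_bigr => t _; rewrite mulr_sumr.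
have -> : \sum_(t <- s) \sum_(t' <- s) (a t * b t' - a t' * b t) ^+ 2 =
    \sum_(t <- s) \sum_(t' <- s) (a t * a t) * (b t' * b t')
    + \sum_(t <- s) \sum_(t' <- s) (b t * b t) * (a t' * a t')
    - \sum_(t <- s) \sum_(t' <- s) (a t * b t) * (a t' * b t' *+ 2).
  rewrite -big_split -sumrB /=; apply: eq_bigr => t _.
  by rewrite -big_split -sumrB /=; apply: eq_bigr => t' _; ring.
by rewrite !dsum sumrMnl; nra.
Qed.

Section FiberForm.
Variables (R : realFieldType) (G : zmodType).

(** Summed over the common value t of k p and k q, this is the l^2 inner product
of the fibre sums of F and H; the form avoids naming the range of t. *)
Definition fiber_form (J : finType) (k : J -> G) (F H : J -> R) : R :=
  \sum_p \sum_(q | k p == k q) F p * H q.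

Lemma fiber_formE (J : finType) (k : J -> G) (s : seq G) F H :
  uniq s -> (forall p, k p \in s) ->
  fiber_form k F H =
  \sum_(t <- s) (\sum_(p | k p == t) F p) * (\sum_(p | k p == t) H p).
Proof.
move=> us ks; under [RHS]eq_bigr do rewrite mulr_suml big_mkcond.
rewrite exchange_big /=; apply: eq_bigr => p _.
rewrite [RHS](bigD1_seq (k p)) //= eqxx [X in _ + X]big1 ?addr0 => [|t]; last first.
  by rewrite eq_sym => /negbTE ->.
by rewrite mulr_sumr; apply: eq_bigl => q; rewrite eq_sym.
Qed.

Lemma fiber_form_CS (J : finType) (k : J -> G) F H :
  fiber_form k F H ^+ 2 <= fiber_form k F F * fiber_form k H H.
Proof.
have us := undup_uniq (codom k).
have ks p : k p \in undup (codom k) by rewrite mem_undup codom_f.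
by rewrite !(fiber_formE _ _ us ks); exact: cauchy_schwarz_seq.
Qed.

Variables (I : finType) (i : I -> G).

(** Weighted count of the solutions of x - y = x' - y', one weight for each of
x, y, x', y'. *)
Definition energy_form (u1 u2 u3 u4 : I -> R) : R :=
  fiber_form (fun p : I * I => i p.1 - i p.2)
    (fun p => u1 p.1 * u2 p.2) (fun p => u3 p.1 * u4 p.2).

Definition self_energy (u : I -> R) : R := energy_form u u u u.

(** The equation x - y = x' - y' is also x - x' = y - y'. *)
Lemma energy_form_swap u v : energy_form u v u v = energy_form u u v v.
Proof.
rewrite /energy_form /fiber_form.
under eq_bigr do rewrite big_mkcond; under [RHS]eq_bigr do rewrite big_mkcond.
rewrite pair_bigA [RHS]pair_bigA /=.
rewrite (reindex (fun pq : (I * I) * (I * I) =>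
   ((pq.1.1, pq.2.1), (pq.1.2, pq.2.2)))) /=; last first.
  exists (fun pq : (I * I) * (I * I) =>
   ((pq.1.1, pq.2.1), (pq.1.2, pq.2.2))); by case=> [[? ?] [? ?]].
apply: eq_bigr => -[[x x'] [y y']] _ /=.
have -> : (i x - i y == i x' - i y') = (i x - i x' == i y - i y').
  by rewrite !subr_eq [in LHS]addrAC [in RHS]addrAC [i y + _]addrC.
by case: ifP => // _; ring.
Qed.

Lemma energy_form_ge0 u1 u2 u3 u4 : (forall x, 0 <= u1 x) -> (forall x, 0 <= u2 x) ->
  (forall x, 0 <= u3 x) -> (forall x, 0 <= u4 x) -> 0 <= energy_form u1 u2 u3 u4.
Proof.
by move=> h1 h2 h3 h4; apply: sumr_ge0 => p _; apply: sumr_ge0 => q _;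
  rewrite !mulr_ge0.
Qed.

(** Cauchy-Schwarz separates the pair of weights (u, v) from (v, v); swapping the
two middle variables then turns (u, v, u, v) into (u, u, v, v), to which
Cauchy-Schwarz applies again. *)
Lemma energy_form_interp (u v : I -> R) : (forall x, 0 <= u x) -> (forall x, 0 <= v x) ->
  energy_form u v v v ^+ 4 <= self_energy u * self_energy v ^+ 3.
Proof.
move=> u0 v0.
have h1 : energy_form u v v v ^+ 2 <= energy_form u u v v * self_energy v.
  by rewrite -energy_form_swap; exact: fiber_form_CS.
have h2 : energy_form u u v v ^+ 2 <= self_energy u * self_energy v.
  exact: fiber_form_CS.
have q0 : 0 <= self_energy v := energy_form_ge0 v0 v0 v0 v0.
have : (energy_form u v v v ^+ 2) ^+ 2 <= (energy_form u u v v * self_energy v) ^+ 2.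
  by rewrite lerXn2r ?nnegrE ?sqr_ge0 // mulr_ge0 // energy_form_ge0.
rewrite -exprM => /le_trans; apply; rewrite exprMn.
by rewrite (exprS _ 2) mulrA ler_wpM2r // exprn_ge0.
Qed.
End FiberForm.

(** The fourth root of the self energy is a norm on nonnegative weights; [q]
bounds the norms of the pieces.  Expanding only the first argument of
self_energy v and interpolating gives N^4 <= (sum_j c_j q_j) N^3 for the norm N
of v. *)
Lemma self_energy_subadditive (R : rcfType) (G : zmodType) (I J : finType) (i : I -> G)
    (c q : J -> R) (u : J -> I -> R) (v : I -> R) :
  (forall j, 0 <= c j) -> (forall j, 0 <= q j) -> (forall j x, 0 <= u j x) ->
  (forall x, v x = \sum_j c j * u j x) ->
  (forall j, self_energy i (u j) <= q j ^+ 4) ->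
  self_energy i v <= (\sum_j c j * q j) ^+ 4.
Proof.
move=> c0 q0 u0 vE uq.
have v0 x : 0 <= v x by rewrite vE sumr_ge0 // => j _; rewrite mulr_ge0.
have Q0 : 0 <= self_energy i v := energy_form_ge0 i v0 v0 v0 v0.
set Q := self_energy i v in Q0 *.
pose N := Num.sqrt (Num.sqrt Q).
have N0 : 0 <= N by exact: sqrtr_ge0.
have N4 : N ^+ 4 = Q by rewrite (exprM _ 2 2) !sqr_sqrtr ?sqrtr_ge0.
have S0 : 0 <= \sum_j c j * q j by apply: sumr_ge0 => j _; rewrite mulr_ge0.
have key : Q <= (\sum_j c j * q j) * N ^+ 3.
  have -> : Q = \sum_j c j * energy_form i (u j) v v v.
    rewrite {1}/Q /self_energy /energy_form /fiber_form.
    under [RHS]eq_bigr do rewrite mulr_sumr.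
    rewrite exchange_big; apply: eq_bigr => p _ /=.
    under [RHS]eq_bigr do rewrite mulr_sumr.
    rewrite exchange_big; apply: eq_bigr => r _ /=.
    by rewrite vE !mulr_suml; apply: eq_bigr => j _; ring.
  rewrite mulr_suml; apply: ler_sum => j _; rewrite -mulrA ler_wpM2l //.
  have e0 : 0 <= energy_form i (u j) v v v by exact: energy_form_ge0.
  have := energy_form_interp i (u0 j) v0; rewrite -/Q -N4 => h.
  rewrite -(@ler_pXn2r _ 4) ?nnegrE ?mulr_ge0 ?exprn_ge0 //.
  rewrite (le_trans h) // [leRHS]exprMn -[N ^+ 4 ^+ 3]exprM -[N ^+ 3 ^+ 4]exprM.
  by rewrite ler_wpM2r ?exprn_ge0.
have [Q_eq0|Nneq] := eqVneq Q 0; first by rewrite Q_eq0 exprn_ge0.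
have Np : 0 < N.
  by rewrite lt_def N0 andbT; apply: contraNneq Nneq => NE; rewrite -N4 NE expr0n.
move: key; rewrite -N4 exprS ler_pM2r ?exprn_gt0 // => NS.
by rewrite -exprS lerXn2r ?nnegrE.
Qed.

(** * Power sums and summation by parts *)

Section PowerSums.
Variable R : realType.
Implicit Types (b s p x y : R) (n k : nat).

(** Bernoulli's inequality, obtained from Young's inequality for y^s and 1. *)
Lemma powR_le_tangent s y : 0 < s <= 1 -> 0 <= y -> y `^ s <= 1 - s * (1 - y).
Proof.
case/andP=> s0; rewrite le_eqVlt => /predU1P[->|s1] y0; first by rewrite powRr1 //; lra.
have s1' : 0 < 1 - s by lra.
have := @conjugate_powR R (y `^ s) 1 s^-1 (1 - s)^-1 (powR_ge0 _ _) ler01.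
rewrite !invr_gt0 !invrK -powRrM mulfV ?gt_eqF // powRr1 // powR1 mulr1.
by move=> /(_ s0 s1') h; apply: le_trans (h _) _; lra.
Qed.

Lemma powR_ge_id b y : 0 < b <= 1 -> 0 <= y <= 1 -> y <= y `^ b.
Proof.
case/andP=> b0 b1 /andP[]; rewrite le_eqVlt => /predU1P[<-|y0] y1.
  exact: powR_ge0.
by rewrite -{1}[y]powRr1 ?(ltW y0) //; apply: ger_powR; rewrite ?y0.
Qed.

(** Factoring out (k+1)^b leaves a number 1 - 1/(k+1) in [0, 1], so that the
bounds on y^b for y in [0, 1] apply. *)
Lemma powR_subSn b k : k.+1%:R `^ b - k%:R `^ b
  = k.+1%:R `^ b * (1 - (1 - k.+1%:R^-1) `^ b) :> R.
Proof.
have K0 : k.+1%:R != 0 :> R by rewrite pnatr_eq0.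
have kE : k%:R = k.+1%:R * (1 - k.+1%:R^-1) :> R.
  by rewrite mulrBr mulr1 divff // -natr1 addrK.
have y0 : 0 <= 1 - k.+1%:R^-1 :> R by rewrite subr_ge0 invf_le1 ?ltr0n // ler1n.
by rewrite {1}kE powRM ?ler0n // mulrBr mulr1.
Qed.

Lemma powR_div_nat b k : k.+1%:R `^ b * k.+1%:R^-1 = k.+1%:R `^ (b - 1) :> R.
Proof. by rewrite powRB ?pnatr_eq0 ?implybT // powRr1. Qed.

Lemma powR_subSn_le b k : 0 < b <= 1 ->
  k.+1%:R `^ b - k%:R `^ b <= k.+1%:R `^ (b - 1) :> R.
Proof.
move=> b01; rewrite powR_subSn -powR_div_nat ler_wpM2l ?powR_ge0 //.
have V1 : k.+1%:R^-1 <= 1 :> R by rewrite invf_le1 ?ltr0n // ler1n.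
have V0 : 0 < k.+1%:R^-1 :> R by rewrite invr_gt0 ltr0n.
have y01 : 0 <= (1 - k.+1%:R^-1 : R) <= 1.
  by rewrite subr_ge0 V1 gerBl ltW.
by rewrite lerBlDl -lerBlDr; exact: powR_ge_id.
Qed.

Lemma powR_subSn_ge s k : 0 < s <= 1 ->
  s * k.+1%:R `^ (s - 1) <= k.+1%:R `^ s - k%:R `^ s :> R.
Proof.
move=> s01; rewrite powR_subSn -powR_div_nat mulrCA ler_wpM2l ?powR_ge0 //.
have V1 : k.+1%:R^-1 <= 1 :> R by rewrite invf_le1 ?ltr0n // ler1n.
have y0 : 0 <= 1 - k.+1%:R^-1 :> R by rewrite subr_ge0.
by have := powR_le_tangent s01 y0; rewrite opprB addrCA subrr addr0 lerBrDl -lerBrDr.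
Qed.

(** The terms are at most the increments of the concave function t^s / s, whose
sum telescopes. *)
Lemma sum_powR_le s n : 0 < s <= 1 ->
  \sum_(k < n) k.+1%:R `^ (s - 1) <= n%:R `^ s / s :> R.
Proof.
move=> s01; have s0 : 0 < s by case/andP: s01.
rewrite ler_pdivlMr // mulrC mulr_sumr.
apply: le_trans (_ : \sum_(k < n) (k.+1%:R `^ s - k%:R `^ s) <= _).
  by apply: ler_sum => k _; exact: powR_subSn_ge.
rewrite -(big_mkord xpredT (fun k => k.+1%:R `^ s - k%:R `^ s)) telescope_sumr //.
by rewrite gerBl powR_ge0.
Qed.

Lemma abel_sum (w g : nat -> R) n : g 0%N = 0 ->
  \sum_(k < n) (w k - w k.+1) * g k.+1
  = \sum_(k < n) w k * (g k.+1 - g k) - w n * g n.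
Proof.
move=> g0; elim: n => [|n IH]; first by rewrite !big_ord0 g0; ring.
by rewrite !big_ord_recr /= IH; ring.
Qed.

(** Chebyshev's inequality: the first k+1 terms are at least w_k. *)
Lemma weak_type_bound (w : nat -> R) p n k : 0 < p ->
  (forall j, 0 <= w j) -> {homo w : i j / (i <= j)%N >-> j <= i} -> (k < n)%N ->
  w k <= (\sum_(j < n) w j `^ p) `^ p^-1 * k.+1%:R `^ (- p^-1).
Proof.
move=> p0 w0 wmon kn.
have K0 : 0 < k.+1%:R :> R by rewrite ltr0n.
rewrite powRN ler_pdivlMr ?powR_gt0 //.
have -> : w k = (w k `^ p) `^ p^-1 by rewrite -powRrM mulfV ?gt_eqF // powRr1.
rewrite -powRM ?powR_ge0 ?ler0n //.
apply: ge0_ler_powR; rewrite ?nnegrE ?invr_ge0 ?(ltW p0) ?mulr_ge0 ?powR_ge0 ?ler0n //.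
  by apply: sumr_ge0 => j _; exact: powR_ge0.
rewrite -(subnKC kn) big_split_ord /=.
apply: le_trans (_ : \sum_(j < k.+1) w j `^ p <= _); last first.
  by rewrite lerDl sumr_ge0 // => j _; exact: powR_ge0.
rewrite mulr_natr -[X in _ *+ X]card_ord -sumr_const.
apply: ler_sum => j _; apply: ge0_ler_powR; rewrite ?nnegrE ?(ltW p0) //.
by apply: wmon; rewrite -ltnS.
Qed.

(** The weighted sum over the level sets that the weights [w] produce.
After summation by parts the weak-type bound leaves the sum of (k+1)^(s-1). *)
Lemma layer_sum_le (w : nat -> R) p s n : 0 < p -> 0 < s -> p^-1 + s <= 1 ->
  (forall j, 0 <= w j) -> {homo w : i j / (i <= j)%N >-> j <= i} -> w n = 0 ->
  \sum_(k < n) (w k - w k.+1) * k.+1%:R `^ (p^-1 + s)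
  <= n%:R `^ s / s * (\sum_(j < n) w j `^ p) `^ p^-1.
Proof.
move=> p0 s0 ps1 w0 wmon wn0.
have pV0 : 0 < p^-1 by rewrite invr_gt0.
rewrite (@abel_sum w (fun k => k%:R `^ (p^-1 + s))) ?powR0 ?gt_eqF ?addr_gt0 //.
rewrite wn0 mul0r subr0.
set P := (\sum_(j < n) _) `^ _.
have s01 : 0 < s <= 1 by lra.
apply: le_trans (_ : (\sum_(k < n) k.+1%:R `^ (s - 1)) * P <= _); last first.
  by rewrite ler_wpM2r ?powR_ge0 // sum_powR_le.
rewrite mulr_suml; apply: ler_sum => k _.
apply: le_trans (ler_wpM2r _ (weak_type_bound p0 w0 wmon (ltn_ord k))) _.
  by rewrite subr_ge0 ge0_ler_powR ?nnegrE ?ler0n ?ler_nat ?addr_ge0 ?ltW.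
rewrite -mulrA mulrC ler_wpM2r ?powR_ge0 //.
have -> : s - 1 = - p^-1 + (p^-1 + s - 1) by ring.
rewrite [leRHS]powRD ?pnatr_eq0 ?implybT // ler_wpM2l ?powR_ge0 //.
by apply: powR_subSn_le; rewrite ps1 addr_gt0.
Qed.
End PowerSums.

(** * Weights bounded through the energy of their level sets *)

Definition indicator (R : pzSemiRingType) (I : finType) (S : {set I}) (x : I) : R :=
  (x \in S)%:R.

Lemma diff_rep_imfset (R : realType) (G : zmodType) (I : finType) (i : I -> G)
    (S : {set I}) t :
  injective i ->
  (diff_rep [fset i x | x in S]%fset t)%:R
  = \sum_(p : I * I | i p.1 - i p.2 == t) indicator R S p.1 * indicator R S p.2.
Proof.
move=> i_inj; rewrite /diff_rep.
transitivity (#|` [fset (i p.1, i p.2) | p in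
    [set p : I * I | [&& p.1 \in S, p.2 \in S & i p.1 - i p.2 == t]] ]%fset|%:R : R).
  congr (#|` _ |%:R); apply/fsetP => -[x y]; rewrite !inE /=.
  apply/andP/imfsetP => /=.
    move=> [/andP[/imfsetP[/= x' x'S ->] /imfsetP[/= y' y'S ->]] xyt].
    by exists (x', y') => //; rewrite inE /= x'S y'S.
  move=> [[x' y']]; rewrite inE /= => /and3P[x'S y'S xyt] [-> ->].
  by rewrite !in_imfset.
rewrite card_imfset; last by move=> [x y] [x' y'] /= [/i_inj -> /i_inj ->].
rewrite -cardE.
rewrite -sum1_card natr_sum [LHS]big_mkcond [RHS]big_mkcond; apply: eq_bigr => p _.
rewrite inE /indicator; case: (p.1 \in S); case: (p.2 \in S); case: (_ == t);
  by rewrite ?mulr1 ?mulr0.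
Qed.

Lemma energy_imfset (R : realType) (G : zmodType) (I : finType) (i : I -> G) (S : {set I}) :
  injective i ->
  (energy [fset i x | x in S]%fset)%:R = self_energy i (indicator R S).
Proof.
move=> i_inj.
pose D := [fset i p.1 - i p.2 | p in {: I * I}]%fset.
have kD p : i p.1 - i p.2 \in D by apply/imfsetP; exists p.
rewrite /self_energy /energy_form.
rewrite (@fiber_formE _ _ _ (fun p : I * I => i p.1 - i p.2) D) ?fset_uniq //.
rewrite /energy (fsbigTE D) ?natr_sum.
  by apply: eq_bigr => t _; rewrite natrX (diff_rep_imfset _ _ _ i_inj).
move=> t tD; apply/eqP; rewrite expn_eq0 andbT -(@pnatr_eq0 R).
rewrite (diff_rep_imfset _ _ _ i_inj) big_pred0 // => p.
by apply: contraNF tD => /eqP <-.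
Qed.

Definition initial_segment n k : {set 'I_n} := [set j : 'I_n | (j <= k)%N].

Lemma layer_cake (R : realType) (w : nat -> R) n (x : 'I_n) : w n = 0 ->
  w x = \sum_(k < n) (w k - w k.+1) * indicator R (initial_segment n k) x.
Proof.
rewrite /indicator /initial_segment.
move=> wn.
have -> : w x = - (w n - w x) by rewrite wn sub0r opprK.
rewrite -(telescope_sumr w (ltnW (ltn_ord x))) -sumrN.
rewrite -(big_mkord xpredT
  (fun k => (w k - w k.+1) * (x \in [set j : 'I_n | (j <= k)%N])%:R)).
rewrite [RHS](big_cat_nat (leq0n x) (ltnW (ltn_ord x))) /=.
rewrite [X in X + _]big1_seq ?add0r => [|k].
  rewrite !big_nat; apply: eq_bigr => k /andP[xk _].
  by rewrite inE xk mulr1 opprB.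
by rewrite mem_index_iota /= inE => kx; rewrite leqNgt kx mulr0.
Qed.

(** A restricted-type bound implies a strong-type bound: as [w] decreases, its
level sets are initial segments, and it is a positive combination of their
indicators. *)
Lemma self_energy_le (R : realType) (G : zmodType) n (i : 'I_n -> G)
    (w : nat -> R) (D p s : R) :
  0 < p -> 0 < s -> p^-1 + s <= 1 ->  0 <= D ->
  (forall j, 0 <= w j) -> {homo w : i j / (i <= j)%N >-> j <= i} -> w n = 0 ->
  (forall k : 'I_n, self_energy i (indicator R (initial_segment n k))
     <= D * k.+1%:R `^ (4 * (p^-1 + s))) ->
  self_energy i (w \o val)
  <= (D `^ (1 / 4) * (n%:R `^ s / s * (\sum_(j < n) w j `^ p) `^ p^-1)) ^+ 4.
Proof.
move=> p0 s0 ps1 D0 w0 wmon wn energy_bound.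
apply: le_trans (self_energy_subadditive (J := 'I_n) (v := w \o val)
  (c := fun k => w k - w k.+1)
  (q := fun k => D `^ (1 / 4) * k.+1%:R `^ (p^-1 + s))
  (u := fun k => indicator R (initial_segment n k)) _ _ _ _ _) _.
- by move=> k; rewrite subr_ge0 wmon.
- by move=> k; rewrite mulr_ge0 ?powR_ge0.
- by move=> k x; rewrite ler0n.
- by move=> x; exact: layer_cake.
- move=> k; apply: le_trans (energy_bound k) _.
  rewrite exprMn -!(@powR_mulrn _ _ 4) ?powR_ge0 // -!powRrM.
  by rewrite divfK ?pnatr_eq0 // powRr1 // [_ * 4]mulrC.
rewrite lerXn2r ?nnegrE ?mulr_ge0 ?powR_ge0 ?invr_ge0 ?(ltW s0) //.
  apply: sumr_ge0 => k _; rewrite !mulr_ge0 ?powR_ge0 // subr_ge0 wmon //.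
under eq_bigr do rewrite mulrCA.
by rewrite -mulr_sumr ler_wpM2l ?powR_ge0 // layer_sum_le.
Qed.

(** * Orthogonality of characters *)

Section HaarIntegrals.
Variable R : realType.

Lemma sin_addM2pi (th : R) (m : int) : sin (th + 2 * pi * m%:~R) = sin th.
Proof.
have sinn t n : sin (t + 2 * pi * n%:R) = sin t :> R.
  by rewrite -(periodicn (@sinD2pi R) n t); congr sin; rewrite -mulr_natr -mulr_natl; ring.
case: m => n; first exact: sinn.
rewrite NegzE -[LHS](sinn _ n.+1); congr sin.
by rewrite mulrNz; ring.
Qed.

Lemma is_derive_sin_affine (c th x : R) : c != 0 ->
  is_derive x 1 (fun x => x + c^-1 * sin (th + c * x)) (1 + cos (th + c * x)).
Proof.
move=> c0.
have h : is_derive x 1 (fun x => th + c * x) c.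
  by apply: is_derive_eq; rewrite /GRing.scale /=; ring.
have : is_derive x 1 (fun x => sin (th + c * x)) (cos (th + c * x) * c).
  exact: (is_derive1_comp (f := @sin R) (g := fun x => th + c * x)).
move=> h2; apply: is_derive_eq.
by rewrite /GRing.scale /=; field.
Qed.

Lemma continuous_cos_affine (c th : R) : continuous (fun x : R => 1 + cos (th + c * x)).
Proof.
move=> x; apply: cvgD; first exact: cvg_cst.
apply: (continuous_comp (f := fun x => th + c * x)); last exact: continuous_cos.
by apply: cvgD; [exact: cvg_cst|apply: cvgM; [exact: cvg_cst|exact: cvg_id]].
Qed.

(** The integrand is 1 + cos rather than cos so that it is nonnegative, which is
what integration against the uniform law and Tonelli's theorem require. *)
Lemma integral_uniform_cos (th : R) (m : int) :
  (\int[uniform_prob (@ltr01 R)]_x (1 + cos (th + 2 * pi * m%:~R * x))%:E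
  = (1 + (m == 0)%:R * cos th)%:E)%E.
Proof.
rewrite integral_uniform; last first.
- by move=> x; rewrite lee_fin -lerBlDl sub0r cos_geN1.
- apply/measurable_EFinP; apply: continuous_measurable_fun; exact: continuous_cos_affine.
rewrite subr0 invr1 mul1e.
have [->|m0] := eqVneq m 0.
  under eq_integral do rewrite mulr0 mul0r addr0.
  rewrite integral_cst //= lebesgue_measure_itv /= lte_fin ltr01 sube0 mule1.
  by rewrite mul1r.
set c := 2 * pi * m%:~R.
have c0 : c != 0 by rewrite /c !mulf_neq0 ?intr_eq0 ?pnatr_eq0 // gt_eqF ?pi_gt0.
have dF x := is_derive_sin_affine th x c0.
have cF : continuous (fun x : R => x + c^-1 * sin (th + c * x)).
  move=> x; apply: differentiable_continuous; apply/derivable1_diffP.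
  by have [] := dF x.
rewrite (@continuous_FTC2 _ (fun x => 1 + cos (th + c * x))
  (fun x => x + c^-1 * sin (th + c * x))) //.
- by rewrite mulr0 addr0 mulr1 sin_addM2pi mul0r addr0 -EFinB; congr EFin; ring.
- by apply: continuous_subspaceT; exact: continuous_cos_affine.
- split.
  + by move=> x _; have [] := dF x.
  + by apply: cvg_at_right_filter; exact: cF.
  + by apply: cvg_at_left_filter; exact: cF.
- by move=> x _; rewrite derive1E; have [] := dF x.
Qed.

Lemma measurable_dot r (m : 'rV[int]_r) :
  measurable_fun [set: r.-tuple (measurableTypeR R)] (dot m).
Proof.
apply: measurable_sum => i; apply: measurable_funM => //; exact: measurable_tnth.
Qed.

Lemma measurable_cos_dot r (m : 'rV[int]_r) (th : R) :
  measurable_fun [set: r.-tuple (measurableTypeR R)]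
    (fun xi => cos (th + 2 * pi * dot m xi)).
Proof.
apply: measurableT_comp; first by apply: continuous_measurable_fun; exact: continuous_cos.
by apply: measurable_funD => //; apply: measurable_funM => //; exact: measurable_dot.
Qed.

Lemma dot_tcons r (m : 'rV[int]_r.+1) z :
  dot m (@tcons R r z) = (m ord0 ord0)%:~R * z.1 + dot (\row_j m ord0 (lift ord0 j)) z.2.
Proof.
rewrite /dot big_ord_recl; congr (_ + _).
by apply: eq_bigr => i _; rewrite mxE tnthS.
Qed.

Lemma row_eq0S r (m : 'rV[int]_r.+1) :
  (m == 0) = (m ord0 ord0 == 0) && (\row_j m ord0 (lift ord0 j) == 0).
Proof.
apply/eqP/andP => [->|[/eqP m0 /eqP m1]].
  by rewrite mxE eqxx; split => //; apply/eqP/rowP => j; rewrite !mxE.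
apply/rowP => j; rewrite mxE; case: (unliftP ord0 j) => [j' ->|->] //.
by have /rowP/(_ j') := m1; rewrite !mxE.
Qed.

(** The phase [th] is arbitrary to make the induction on r work: integrating out
the last r coordinates leaves the first one in the phase.  Shifting [th] by a
quarter of a period also covers the sine. *)
Lemma integral_haar_1cos r (m : 'rV[int]_r) (th : R) :
  (\int[haar r]_xi (1 + cos (th + 2 * pi * dot m xi))%:E
  = (1 + (m == 0)%:R * cos th)%:E)%E.
Proof.
have nneg (t : R) : (0 <= (1 + cos t)%:E)%E by rewrite lee_fin -lerBlDl sub0r cos_geN1.
have mc q (m' : 'rV[int]_q) (t : R) : measurable_fun [set: q.-tuple (measurableTypeR R)]
    (fun xi => (1 + cos (t + 2 * pi * dot m' xi))%:E).
  by apply/measurable_EFinP; apply: measurable_funD => //; exact: measurable_cos_dot.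
elim: r m th => [|r IH] m th.
  rewrite [LHS]integral_dirac //; last exact: mc.
  rewrite /= diracT mul1e /dot big_ord0 mulr0 addr0.
  by rewrite (_ : m = 0) ?eqxx ?mul1r //; apply/rowP => -[].
rewrite [LHS]ge0_integral_distribution //.
rewrite [LHS]fubini_tonelli1; [
  |by apply: measurableT_comp; [exact: mc|exact: measurable_tcons]
  |by move=> x; exact: nneg].
pose m' := \row_j m ord0 (lift ord0 j).
rewrite /fubini_F.
transitivity (\int[uniform_prob (@ltr01 R)]_x
  (1 + (m' == 0)%:R * cos (th + 2 * pi * (m ord0 ord0)%:~R * x))%:E)%E.
  apply: eq_integral => x _; rewrite -IH; apply: eq_integral => y _ /=.
  by rewrite dot_tcons /=; congr (1 + cos _)%:E; ring.
rewrite row_eq0S -/m'; case: (m' == 0); last first.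
  rewrite andbF; under eq_integral do rewrite mul0r.
  by rewrite integral_cst // mul0r addr0 mul1e; exact: probability_setT.
rewrite andbT; under eq_integral do rewrite mul1r.
exact: integral_uniform_cos.
exact: mc.
Qed.

Lemma integrable_cos_dot r (m : 'rV[int]_r) (th : R) :
  (haar r).-integrable setT
    (fun xi : r.-tuple (measurableTypeR R) => (cos (th + 2 * pi * dot m xi))%:E).
Proof.
apply: (@le_integrable _ _ _ _ _ measurableT _ (cst 1%E)).
- by apply/measurable_EFinP; exact: measurable_cos_dot.
- by move=> x _; rewrite /= normr1 lee_fin cos_max.
- by apply: finite_measure_integrable_cst.
Qed.

Lemma integral_haar_cos r (m : 'rV[int]_r) (th : R) :
  (\int[haar r]_xi (cos (th + 2 * pi * dot m xi))%:E = ((m == 0)%:R * cos th)%:E)%E.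
Proof.
have i1 : (haar r).-integrable setT (EFin \o cst (1 : R)).
  exact: finite_measure_integrable_cst.
have := integral_haar_1cos m th.
under eq_integral do rewrite EFinD.
rewrite integralD //; last exact: integrable_cos_dot.
rewrite integral_cst // EFinD.
rewrite [X in ((_ * X + _)%E = _)]probability_setT mul1e.
by case: (integral _ _ _) => [x||] //; rewrite -!EFinD => -[/addrI ->].
Qed.
End HaarIntegrals.

(** * Expansion of the fourth power *)

Section Expansion.
Variable R : realType.
Implicit Types (z : R[i]) (I : finType).

Lemma conjc_sum I (z : I -> R[i]) : (\sum_x z x)^*%C = \sum_x (z x)^*%C.
Proof. exact: (big_morph _ (rmorphD _) (rmorph0 _)). Qed.

Lemma Re_sum I (z : I -> R[i]) : complex.Re (\sum_x z x) = \sum_x complex.Re (z x).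
Proof. by elim/big_rec2: _ => [|x a b _ <-] //; case: (z x) => ? ?; case: b. Qed.

Lemma normc_sq z : Normc.normc z ^+ 2 = complex.Re (z * z^*%C).
Proof. by case: z => a b /=; rewrite sqr_sqrtr ?addr_ge0 ?sqr_ge0 //; ring. Qed.

Lemma normc_conjc z : Normc.normc z^*%C = Normc.normc z.
Proof. by case: z => a b /=; rewrite sqrrN. Qed.

Lemma Re_le_normc z : complex.Re z <= Normc.normc z.
Proof.
case: z => a b /=; rewrite (le_trans (ler_norm a)) // -sqrtr_sqr.
by rewrite ler_wsqrtr // lerDl sqr_ge0.
Qed.

Lemma mulc_conjc_sum I (z : I -> R[i]) :
  (\sum_x z x) * (\sum_x z x)^*%C = \sum_(p : I * I) z p.1 * (z p.2)^*%C.
Proof.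
rewrite conjc_sum mulr_suml; under eq_bigr do rewrite mulr_sumr.
by rewrite pair_bigA.
Qed.

Lemma normc4_sum I (z : I -> R[i]) :
  Normc.normc (\sum_x z x) ^+ 4 = \sum_(p : I * I) \sum_(q : I * I)
    complex.Re ((z p.1 * (z p.2)^*%C) * (z q.1 * (z q.2)^*%C)^*%C).
Proof.
transitivity (Normc.normc ((\sum_x z x) * (\sum_x z x)^*%C) ^+ 2).
  by rewrite Normc.normcM normc_conjc -expr2 -exprM.
by rewrite mulc_conjc_sum normc_sq mulc_conjc_sum Re_sum pair_bigA.
Qed.

Lemma expiBE (c c' : R[i]) (a b : R) :
  (c * expi a) * (c' * expi b)^*%C = (c * c'^*%C) * expi (a - b).
Proof.
case: c c' => [x y] [x' y']; rewrite /expi cosB sinB /=.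
by apply/eqP; rewrite eq_complex /=; apply/andP; split; apply/eqP; ring.
Qed.

End Expansion.

Section TrigSum.
Variable R : realType.

Lemma dotB r (m m' : 'rV[int]_r) (xi : r.-tuple R) : dot (m - m') xi = dot m xi - dot m' xi.
Proof.
rewrite /dot -sumrB; apply: eq_bigr => j _.
by rewrite !mxE intrB mulrBl.
Qed.

(** Real and imaginary part of [c] are both paired with a cosine, the sine being
a shifted cosine. *)
Lemma Re_mul_expi (c : R[i]) (t : R) :
  complex.Re (c * expi (- t))
  = complex.Re c * cos (0 + t) + complex.Im c * cos (- (pi / 2) + t).
Proof.
case: c => x y; rewrite /expi add0r [- (pi / 2) + t]addrC cosBpihalf cosN sinN /=; ring.
Qed.

Lemma normc_ge0 (z : R[i]) : 0 <= Normc.normc z.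
Proof. by case: z => x y; exact: sqrtr_ge0. Qed.

Variables (G : zmodType) (r : nat) (I : finType) (i : I -> G) (m : I -> 'rV[int]_r).
Hypothesis freq_eq : forall p q : I * I,
  (m p.1 - m p.2 == m q.1 - m q.2) = (i p.1 - i p.2 == i q.1 - i q.2).

(** Parseval's identity for the square of the modulus of F, in the form of an
upper bound.  Only quadruples with M p q = 0 survive the integration, and
[freq_eq] identifies these with the quadruples counted by the energy form. *)
Lemma L4_norm_trig_sum_le (c : I -> R[i]) (F : r.-tuple R -> R[i]) (B : R) :
  (forall xi, F xi = \sum_x c x * expi (- (2 * pi * dot (m x) xi))) ->
  0 <= B ->
  self_energy i (@Normc.normc R \o c) <= B ^+ 4 ->
  (L4_norm F <= B%:E)%E.
Proof.
move=> FE B0 le_B4.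
pose g p := c p.1 * (c p.2)^*%C.
pose h p q := g p * (g q)^*%C.
pose M (p q : I * I) := (m p.1 - m p.2) - (m q.1 - m q.2).
have F4 xi : Normc.normc (F xi) ^+ 4 = \sum_p \sum_q
    (complex.Re (h p q) * cos (0 + 2 * pi * dot (M p q) xi)
     + complex.Im (h p q) * cos (- (pi / 2) + 2 * pi * dot (M p q) xi)).
  rewrite FE normc4_sum; apply: eq_bigr => p _; apply: eq_bigr => q _.
  by rewrite !expiBE -Re_mul_expi !dotB; congr (complex.Re (_ * expi _)); ring.
have int_cos p q (th : R) (k : R) : (haar r).-integrable classical_sets.setT
    (fun xi : r.-tuple (measurableTypeR R) => (k * cos (th + 2 * pi * dot (M p q) xi))%:E).
  under eq_fun do rewrite EFinM.
  by apply: integrableZl => //; exact: integrable_cos_dot.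
have intF4 : (\int[haar r]_xi (Normc.normc (F xi) ^+ 4)%:E
    = (\sum_p \sum_q (M p q == 0)%:R * complex.Re (h p q))%:E)%E.
  under eq_integral do rewrite F4 -sumEFin.
  rewrite integral_sum //; last first.
    move=> p; under eq_fun do rewrite -sumEFin.
    apply: integrable_sum => // q _; under eq_fun do rewrite EFinD.
    by apply: integrableD.
  rewrite -sumEFin; apply: eq_bigr => p _.
  under eq_integral do rewrite -sumEFin.
  rewrite integral_sum //; last first.
    by move=> q; under eq_fun do rewrite EFinD; apply: integrableD.
  rewrite -sumEFin; apply: eq_bigr => q _.
  under eq_integral do rewrite EFinD.
  rewrite integralD //.
  under eq_integral do rewrite EFinM.
  rewrite integralZl //; last exact: integrable_cos_dot.
  under [X in (_ + X)%E]eq_integral do rewrite EFinM.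
  rewrite integralZl //; last exact: integrable_cos_dot.
  by rewrite !integral_haar_cos cosN cos_pihalf cos0 -!EFinM -EFinD; congr EFin; ring.
have V_le : \sum_p \sum_q (M p q == 0)%:R * complex.Re (h p q) <= B ^+ 4.
  apply: le_trans le_B4; rewrite /self_energy /energy_form /fiber_form.
  apply: ler_sum => p _; rewrite [leRHS]big_mkcond; apply: ler_sum => q _.
  rewrite -freq_eq -[m p.1 - _ == _]subr_eq0 -/(M p q).
  case: (M p q == 0); last by rewrite mul0r.
  by rewrite mul1r (le_trans (Re_le_normc _)) // /h /g !(Normc.normcM, normc_conjc).
have V_ge0 : 0 <= \sum_p \sum_q (M p q == 0)%:R * complex.Re (h p q).
  rewrite -lee_fin -intF4 integral_ge0 // => xi _.
  by rewrite lee_fin exprn_ge0 // normc_ge0.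
rewrite /L4_norm unlock.
under eq_integral => xi _.
  rewrite abse_EFin ger0_norm ?normc_ge0 // poweR_EFin powR_mulrn ?normc_ge0 //.
  over.
rewrite intF4 poweR_EFin lee_fin.
have -> : B = (B ^+ 4) `^ 4^-1 by rewrite -powR_mulrn // -powRrM mulfV ?pnatr_eq0 // powRr1.
by apply: ge0_ler_powR; rewrite ?nnegrE ?invr_ge0 ?exprn_ge0 ?ler0n.
Qed.
End TrigSum.

(** * The theorem *)

(** The differences are moved to sums x + y' = x' + y, because psi is additive
and injective only on the subgroup generated by X. *)
Lemma identification_sub_eq (G : zmodType) (X : {fset G}) r (psi : G -> 'rV[int]_r)
    x y x' y' :
  is_identification X psi -> x \in X -> y \in X -> x' \in X -> y' \in X ->
  (psi x - psi y == psi x' - psi y') = (x - y == x' - y').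
Proof.
case=> psiD [_ psi_inj _] xX yX x'X y'X.
have genX z : z \in X -> gen_subgroup X z by move=> zX A [_]; exact.
have genD z t : gen_subgroup X z -> gen_subgroup X t -> gen_subgroup X (z + t).
  move=> zX tX A [[A0 AB] XA].
  have zA : A z by apply: zX; split.
  have tA : A t by apply: tX; split.
  by rewrite -[t]opprK; apply: (AB) => //; rewrite -sub0r; exact: AB.
have cross (V : zmodType) (u v u' v' : V) : (u - v == u' - v') = (u + v' == u' + v).
  by rewrite !subr_eq addrAC eq_sym subr_eq eq_sym.
rewrite !cross -!psiD; try exact: genX.
apply/eqP/eqP => [psi_eq|-> //].
by apply: psi_inj psi_eq; rewrite inE; apply: genD; exact: genX.
Qed.

(** The last clause transfers the sums over G in the Fourier series and in the
l^p norm to sums over 'I_#|X|. *)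
Lemma decreasing_enumeration (R : realType) (G : zmodType) (X : {fset G}) (v : G -> R) :
  (forall x, 0 <= v x) ->
  exists (i : 'I_#|`X| -> G) (w : nat -> R),
  [/\ injective i /\ forall j, i j \in X, forall j, v (i j) = w j,
      (forall k, 0 <= w k) /\ {homo w : j k / (j <= k)%N >-> k <= j}, w #|`X| = 0 &
      forall (W : nmodType) (F : G -> W), (forall x, x \notin X -> F x = 0) ->
        \sum_(x \in classical_sets.setT) F x = \sum_j F (i j)].
Proof.
move=> v0; pose e x y := v y <= v x.
pose s := sort e X.
have sX : perm_eq s X by rewrite perm_sort.
have size_s : size s = #|`X| by rewrite (perm_size sX).
have s_uniq : uniq s by rewrite (perm_uniq sX) fset_uniq.
have es : sorted e s by apply: sort_sorted => x y; exact: le_total.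
pose w k := nth 0 (map v s) k.
have w0 k : 0 <= w k.
  have [ks|sk] := ltnP k (size s); last by rewrite /w nth_default ?size_map.
  by rewrite /w (nth_map 0).
exists (fun j => nth 0 s j), w; split.
- split.
    move=> j k /eqP; rewrite nth_uniq ?size_s ?ltn_ord // => /eqP; exact: val_inj.
  by move=> j; rewrite -(perm_mem sX) mem_nth ?size_s.
- by move=> j; rewrite /w (nth_map 0) ?size_s.
- split=> // j k jk.
  have [ks|sk] := ltnP k (size s); last by rewrite [w k]nth_default ?size_map.
  have js := leq_ltn_trans jk ks; rewrite /w !(nth_map 0) //.
  have e_trans : transitive e by move=> x y z yx xz; exact: le_trans xz yx.
  have e_refl : reflexive e by move=> x; exact: lexx.
  exact: (sorted_leq_nth e_trans e_refl 0 es).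
- by rewrite /w nth_default // size_map size_s.
- move=> W F F0; rewrite (fsbigTE X) // -(perm_big _ sX) (big_nth 0) size_s.
  by rewrite big_mkord.
Qed.

Lemma card_initial_segment (G : zmodType) n (i : 'I_n -> G) (k : 'I_n) : injective i ->
  #|` [fset i x | x in initial_segment n k]%fset| = k.+1.
Proof.
move=> i_inj; rewrite card_imfset //= -cardE cardsE.
have widen_inj : injective (widen_ord (ltn_ord k)) by move=> x y /(congr1 val) /= /val_inj.
rewrite -[RHS]card_ord -(fintype.card_image widen_inj).
apply: eq_card => j; apply/idP/fintype.imageP => [jk|[x _ ->]]; last exact: (ltn_ord x).
by exists (Ordinal (n := k.+1) jk) => //; exact: val_inj.
Qed.

Theorem proposition5p1 (R : realType) (a eps : R) :
  2 <= a < 3 -> 0 < eps ->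
  exists2 eta : R, 0 < eta & exists2 M : R, 0 < M &
  forall (G : zmodType) (X : {fset G}) (K : R) (C : R -> R),
    torsion_free G -> 1 <= K ->
    (forall eta' : R, 0 < eta' -> forall A : {fset G}, (A `<=` X)%fset ->
       (energy A)%:R <= C eta' * K `^ (3 - a) * #|` A|%:R `^ (a + eta')) ->
  forall (r : nat) (psi : G -> 'rV[int]_r), is_identification X psi ->
  forall f : G -> R[i], supported_on X f ->
    (L4_norm (fourier psi f) <=
     (M * C eta `^ (1 / 4) * K `^ ((3 - a) / 4) * #|` X|%:R `^ eps
        * lp_norm (4 / a) f)%:E)%E.
Proof.
move=> /andP[a2 a3] eps0.
(* s = eta / 4; the bound 4^-1 makes a / 4 + s <= 1 for all a < 3. *)
pose s := Num.min eps 4^-1.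
have s0 : 0 < s by rewrite lt_min eps0 invr_gt0 ltr0n.
have s_eps : s <= eps by rewrite ge_min lexx.
have s4 : s <= 4^-1 by rewrite ge_min lexx orbT.
have a0 : 0 < a by lra.
exists (4 * s); first by rewrite mulr_gt0.
exists s^-1; first by rewrite invr_gt0.
move=> G X K C _ K1 energy_bound r psi psi_id f f_supp.
have [i [w [[i_inj iX] wE [w0 w_mono] wn sumE]]] :=
  decreasing_enumeration X (fun x => normc_ge0 (f x)).
set n := #|`X| in i i_inj iX wE wn sumE *.
have p0 : 0 < 4 / a by rewrite divr_gt0.
have lpE : lp_norm (4 / a) f = (\sum_(j < n) w j `^ (4 / a)) `^ (4 / a)^-1.
  rewrite /lp_norm sumE => [|x xX]; last by rewrite f_supp // Normc.normc0 powR0 ?gt_eqF.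
  by congr (_ `^ _); apply: eq_bigr => j _; rewrite wE.
apply: (@L4_norm_trig_sum_le R G r _ i (psi \o i) _ (f \o i)).
- by move=> p q /=; exact: (identification_sub_eq psi_id).
- by move=> xi; rewrite /fourier sumE // => x xX; rewrite f_supp // mul0r.
- by rewrite !mulr_ge0 ?powR_ge0 // invr_ge0 ltW.
have -> : @Normc.normc R \o (f \o i) = w \o val by apply/funext => j; rewrite /= wE.
have [n0|n_gt0] := posnP n.
  rewrite /self_energy /energy_form /fiber_form big1 => [|[x y] _]; last first.
    by exfalso; case: x => x; rewrite n0.
  by rewrite exprn_ge0 // !mulr_ge0 ?powR_ge0 // invr_ge0 ltW.
have n1 : 1 <= n%:R :> R by rewrite ler1n.
have eta0 : 0 < 4 * s by rewrite mulr_gt0.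
have K3 : 0 < K `^ (3 - a) by rewrite powR_gt0 //; lra.
(* Taking A = X in the hypothesis shows that C_eta is nonnegative. *)
have D0 : 0 <= C (4 * s) * K `^ (3 - a).
  have n_pow : 0 < n%:R `^ (a + 4 * s) :> R by rewrite powR_gt0 // ltr0n.
  rewrite -(pmulr_lge0 _ n_pow); apply: le_trans (energy_bound _ eta0 X (fsubset_refl X)).
  exact: ler0n.
have C0 : 0 <= C (4 * s) by rewrite -(pmulr_lge0 _ K3).
apply: le_trans (self_energy_le p0 s0 _ D0 w0 w_mono wn _) _.
- by rewrite invf_div; lra.
- move=> k; rewrite -energy_imfset //.
  apply: le_trans (energy_bound _ eta0 _ _) _.
    by apply/fsubsetP => x /imfsetP[j _ ->].
  rewrite card_initial_segment // (_ : a + 4 * s = 4 * ((4 / a)^-1 + s)) //.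
  by rewrite invf_div; field.
rewrite -lpE; apply: lerXn2r; rewrite ?nnegrE.
- by rewrite !mulr_ge0 ?powR_ge0 // invr_ge0 ltW.
- by rewrite !mulr_ge0 ?powR_ge0 // invr_ge0 ltW.
rewrite powRM ?powR_ge0 // -powRrM mulrA ler_wpM2r ?powR_ge0 //.
rewrite [leRHS](_ : _ =
  C (4 * s) `^ (1 / 4) * K `^ ((3 - a) / 4) * (n%:R `^ eps / s)); last by ring.
rewrite mul1r ler_wpM2l ?mulr_ge0 ?powR_ge0 // ler_wpM2r ?invr_ge0 ?(ltW s0) //.
by rewrite ler_powR.
Qed.
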